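(* Let $(\mathcal{A},\{\,,\},\bullet)$ be a Poisson superalgebra over $\mathbb{K}$ and $(V,\{\,,\}_1,\bullet_1,\psi_{\{,\}},\psi_\bullet)$ an $\mathcal{A}$-module Poisson superalgebra. Let $\lambda\in\mathbb{K}$ and let the even linear map $T:V\to\mathcal{A}$ be an $\mathcal{O}$-operator of weight $\lambda$ associated to $(V,\{\,,\}_1,\bullet_1,\psi_{\{,\}},\psi_\bullet)$. Define even bilinear operations on $V$ by $$[u,v]=\lambda\{u,v\}_1,\quad u\diamond v=\psi_{\{,\}}(T(u))v,\quad u\cdot v=\lambda\,u\bullet_1v,\quad u\succ v=\psi_\bullet(T(u))v,\qquad u,v\in V.$$ Then $(V,[\cdot,\cdot],\diamond,\cdot,\succ)$ is a (left) post-Poisson superalgebra, and $T$ is a homomorphism of Poisson superalgebras from its associated Poisson superalgebra $P(V)$ to $(\mathcal{A},\{\,,\},\bullet)$.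
   Context: $\mathbb{K}$ is a field of characteristic $0$; $|x|\in\mathbb{Z}_2$ is the parity of a homogeneous element; identities are for homogeneous elements. A Poisson superalgebra $(\mathcal{P},\{\,,\},\bullet)$ is a $\mathbb{Z}_2$-graded vector space with two even bilinear maps such that: (i) $\{x,y\}=-(-1)^{|x||y|}\{y,x\}$ and $(-1)^{|x||z|}\{x,\{y,z\}\}+(-1)^{|z||y|}\{z,\{x,y\}\}+(-1)^{|y||x|}\{y,\{z,x\}\}=0$; (ii) $x\bullet y=(-1)^{|x||y|}y\bullet x$ and $x\bullet(y\bullet z)=(x\bullet y)\bullet z$; (iii) $\{x,y\bullet z\}=\{x,y\}\bullet z+(-1)^{|x||y|}y\bullet\{x,z\}$. A homomorphism of Poisson superalgebras is a linear map preserving both operations. Given Poisson superalgebras $(\mathcal{A},\{\,,\},\bullet)$, $(V,\{\,,\}_1,\bullet_1)$ and even linear maps $\psi_{\{,\}},\psi_\bullet:\mathcal{A}\to End(V)$, the tuple $(V,\{\,,\}_1,\bullet_1,\psi_{\{,\}},\psi_\bullet)$ is an $\mathcal{A}$-module Poisson superalgebra if for $x,y\in\mathcal{A}$, $u,v\in V$: (1) $\psi_{\{,\}}(\{x,y\})=\psi_{\{,\}}(x)\psi_{\{,\}}(y)-(-1)^{|x||y|}\psi_{\{,\}}(y)\psi_{\{,\}}(x)$ and $\psi_{\{,\}}(x)\{u,v\}_1=\{\psi_{\{,\}}(x)u,v\}_1+(-1)^{|x||u|}\{u,\psi_{\{,\}}(x)v\}_1$; (2) $\psi_\bullet(x\bullet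 y)=\psi_\bullet(x)\psi_\bullet(y)$ and $\psi_\bullet(x)(u\bullet_1v)=(\psi_\bullet(x)u)\bullet_1v$; (3) $\psi_{\{,\}}(x\bullet y)=\psi_\bullet(x)\psi_{\{,\}}(y)+(-1)^{|x||y|}\psi_\bullet(y)\psi_{\{,\}}(x)$ and $\psi_\bullet(\{x,y\})=\psi_{\{,\}}(x)\psi_\bullet(y)-(-1)^{|x||y|}\psi_\bullet(y)\psi_{\{,\}}(x)$; (4) $\psi_{\{,\}}(x)(u\bullet_1v)=(\psi_{\{,\}}(x)u)\bullet_1v+(-1)^{|x||u|}u\bullet_1(\psi_{\{,\}}(x)v)$ and $\psi_\bullet(x)\{u,v\}_1=(\psi_{\{,\}}(x)u)\bullet_1v+(-1)^{|x||u|}\{u,\psi_\bullet(x)v\}_1$. An even linear map $T:V\to\mathcal{A}$ is an $\mathcal{O}$-operator of weight $\lambda$ associated to $(V,\{\,,\}_1,\bullet_1,\psi_{\{,\}},\psi_\bullet)$ if for all homogeneous $u,v\in V$ $\{T(u),T(v)\}=T\big(\psi_{\{,\}}(T(u))v-(-1)^{|u||v|}\psi_{\{,\}}(T(v))u+\lambda\{u,v\}_1\big)$ and $T(u)\bullet T(v)=T\big(\psi_\bullet(T(u))v+(-1)^{|u||v|}\psi_\bullet(T(v))u+\lambda u\bullet_1v\big)$. A (left) post-Poisson superalgebra is a $\mathbb{Z}_2$-graded vector space with four even bilinear operations $[\cdot,\cdot],\diamond,\cdot,\succ$ such that: (post-Lie) $[\cdot,\cdot]$ is a Lie superbracket (as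 in (i)); $(-1)^{|z||y|}z\diamond(y\diamond x)-y\diamond(z\diamond x)+(y\diamond z)\diamond x-(-1)^{|z||y|}(z\diamond y)\diamond x+[y,z]\diamond x=0$; $z\diamond[x,y]-[z\diamond x,y]-(-1)^{|z||x|}[x,z\diamond y]=0$; (commutative dendriform supertrialgebra) $x\cdot y=(-1)^{|x||y|}y\cdot x$; $(x\cdot y)\cdot z=x\cdot(y\cdot z)$; $x\succ(y\succ z)=(x\succ y+(-1)^{|x||y|}y\succ x+x\cdot y)\succ z$; $(x\succ y)\cdot z=x\succ(y\cdot z)$; (compatibility) $[x,y\cdot z]=[x,y]\cdot z+(-1)^{|x||y|}y\cdot[x,z]$; $[x,z\succ y]=(-1)^{|x||z|}z\succ[x,y]-(-1)^{|y||z|+|x||y|+|x||z|}y\cdot(z\diamond x)$; $x\diamond(y\cdot z)=(x\diamond y)\cdot z+(-1)^{|x||y|}y\cdot(x\diamond z)$; $(y\succ z+(-1)^{|y||z|}z\succ y+y\cdot z)\diamond x=(-1)^{|y||z|}z\succ(y\diamond x)+y\succ(z\diamond x)$; $x\diamond(z\succ y)=(-1)^{|x||z|}z\succ(x\diamond y)+(x\diamond z-(-1)^{|x||z|}z\diamond x+[x,z])\succ y$. The associated Poisson superalgebra $P(V)$ of a post-Poisson superalgebra $(V,[\cdot,\cdot],\diamond,\cdot,\succ)$ is $V$ with the operations $\{u,v\}=u\diamond v-(-1)^{|u||v|}v\diamond u+[u,v]$ and $u\bullet v=u\succ v+(-1)^{|u||v|}v\succ u+u\cdot v$ (these form a Poisson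 superalgebra). *)

(* Defs.v *)
From HB Require Import structures.
From mathcomp Require Import all_boot all_order all_algebra.

Set Implicit Arguments.
Unset Strict Implicit.
Unset Printing Implicit Defensive.

Import GRing.Theory.
Local Open Scope ring_scope.

(* The group Z_2 of parities is bool: false is even, true is odd, and addition
   is the exclusive or (+).  In an exponent of -1, parities coerce to the
   natural numbers 0 and 1, so that (-1) ^+ (i * j) is the usual Koszul sign. *)
Record superspace (K : fieldType) := Superspace {
  supersort :> lmodType K;
  homog : bool -> {pred supersort};
  homog_submod : forall i, submod_closed (homog i);
  homog_sum : forall v : supersort, exists v0 v1 : supersort,
    [/\ v0 \in homog false, v1 \in homog true & v = v0 + v1];
  homog_cap : forall v, v \in homog false -> v \in homog true -> v = 0
}.
Arguments homog {K} s.
Arguments homog_submod {K} s i.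

Section ParityParts.
Variables (K : fieldType) (V : superspace K).
Implicit Types (i j : bool) (u v : V).

Lemma homog_split v : exists w : V, (w \in homog V false) && (v - w \in homog V true).
Proof.
have [v0 [v1 [v0P v1P ->]]] := homog_sum v.
by exists v0; rewrite v0P addrC addKr.
Qed.

Definition parity_part i v : V :=
  if i then v - xchoose (homog_split v) else xchoose (homog_split v).
Arguments parity_part : simpl never.

Lemma parity_partP i v : parity_part i v \in homog V i.
Proof. by have /andP[] := xchooseP (homog_split v); case: i. Qed.

Lemma parity_part_sum v : parity_part false v + parity_part true v = v.
Proof. exact: subrKC. Qed.

Lemma homog0 i : 0 \in homog V i.
Proof. by have [] := homog_submod V i. Qed.

Lemma homogB i u v : u \in homog V i -> v \in homog V i -> u - v \in homog V i.
Proof.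
move=> ui vi; have [_ Vlin] := homog_submod V i.
by rewrite addrC -scaleN1r Vlin.
Qed.

Lemma parity_part_homog i j v :
  v \in homog V i -> parity_part j v = if i == j then v else 0.
Proof.
have p0 := parity_partP false v; have p1 := parity_partP true v.
have p0E : parity_part false v = v - parity_part true v.
  by rewrite -[X in X - _](parity_part_sum v) addrK.
have p1E : parity_part true v = v - parity_part false v by [].
case: i => vi.
- have z : parity_part false v = 0 by apply: homog_cap => //; rewrite p0E homogB.
  by case: j; rewrite /= ?p1E z ?subr0.
- have z : parity_part true v = 0 by apply: homog_cap => //; rewrite p1E homogB.
  by case: j; rewrite /= ?p0E z ?subr0.
Qed.

End ParityParts.

Definition even_linear (K : fieldType) (V W : superspace K) (f : V -> W) : Prop :=
  linear f /\ forall i, {in homog V i, forall v, f v \in homog W i}.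

(* For op : A -> V -> V this says that op is an even linear map from A to the
   superspace End(V), whose part of parity i consists of the endomorphisms
   sending each homog V j into homog V (i (+) j). *)
Definition even_bilinear (K : fieldType) (U V W : superspace K)
    (op : U -> V -> W) : Prop :=
  bilinear_for *:%R *:%R op /\
  forall i j, {in homog U i & homog V j, forall u v, op u v \in homog W (i (+) j)}.

(* The bilinear map which is (u, v) |-> (-1)^(|u||v|) op v u on homogeneous
   elements; see superflipE. *)
Definition superflip (K : fieldType) (V : superspace K) (op : V -> V -> V)
    (u v : V) : V :=
  \sum_(i : bool) \sum_(j : bool)
    (-1) ^+ (i * j) *: op (parity_part j v) (parity_part i u).

Lemma superflipE (K : fieldType) (V : superspace K) (op : V -> V -> V) i j u v :
  even_bilinear op -> u \in homog V i -> v \in homog V j ->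
  superflip op u v = (-1) ^+ (i * j) *: op v u.
Proof.
move=> [[opl opr] _] ui vj.
have op0l w : op 0 w = 0.
  by have := opl w (-1) 0 0; rewrite scaler0 addr0 /= scaleN1r addNr.
have op0r w : op w 0 = 0.
  by have := opr w (-1) 0 0; rewrite scaler0 addr0 /= scaleN1r addNr.
rewrite /superflip !big_bool !(parity_part_homog _ ui) !(parity_part_homog _ vj).
by case: i {ui}; case: j {vj}; rewrite /= ?op0l ?op0r !scaler0 ?addr0 ?add0r.
Qed.

(* In the identities below, i, j, k are the parities of the successive
   homogeneous arguments. *)

Record super_lie (K : fieldType) (L : superspace K) (br : L -> L -> L) : Prop :=
  SuperLie {
  lie_even : even_bilinear br;
  lie_skew : forall i j, {in homog L i & homog L j, forall x y,
    br x y = - ((-1) ^+ (i * j) *: br y x)};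
  lie_jacobi : forall i j k, {in homog L i & homog L j & homog L k, forall x y z,
    (-1) ^+ (i * k) *: br x (br y z) + (-1) ^+ (k * j) *: br z (br x y)
      + (-1) ^+ (j * i) *: br y (br z x) = 0}
}.

Record poisson_superalgebra (K : fieldType) (P : superspace K)
    (br mul : P -> P -> P) : Prop := PoissonSuperalgebra {
  poisson_lie : super_lie br;
  poisson_mul_even : even_bilinear mul;
  poisson_mulC : forall i j, {in homog P i & homog P j, forall x y,
    mul x y = (-1) ^+ (i * j) *: mul y x};
  poisson_mulA : forall i j k, {in homog P i & homog P j & homog P k, forall x y z,
    mul x (mul y z) = mul (mul x y) z};
  poisson_leibniz : forall i j k, {in homog P i & homog P j & homog P k, forall x y z,
    br x (mul y z) = mul (br x y) z + (-1) ^+ (i * j) *: mul y (br x z)}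
}.

Record poisson_hom (K : fieldType) (P Q : superspace K)
    (brP mulP : P -> P -> P) (brQ mulQ : Q -> Q -> Q) (f : P -> Q) : Prop :=
  PoissonHom {
  hom_source : poisson_superalgebra brP mulP;
  hom_target : poisson_superalgebra brQ mulQ;
  hom_linear : linear f;
  hom_br : {morph f : u v / brP u v >-> brQ u v};
  hom_mul : {morph f : u v / mulP u v >-> mulQ u v}
}.

(* (A, brA, mulA) is meant to be a Poisson superalgebra.  psib and psim are the
   actions attached to the bracket and to the product.  In mod_mul_br the first
   term on the right is mul1 (psib x u) v, not br1 (psim x u) v. *)
Record module_poisson_superalgebra (K : fieldType) (A V : superspace K)
    (brA mulA : A -> A -> A) (br1 mul1 : V -> V -> V) (psib psim : A -> V -> V) : Prop :=
  ModulePoissonSuperalgebra {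
  mod_poisson : poisson_superalgebra br1 mul1;
  mod_psib_even : even_bilinear psib;
  mod_psim_even : even_bilinear psim;
  mod_psib_br : forall i j, {in homog A i & homog A j, forall x y v,
    psib (brA x y) v = psib x (psib y v) - (-1) ^+ (i * j) *: psib y (psib x v)};
  mod_br_br : forall i j k, {in homog A i & homog V j & homog V k, forall x u v,
    psib x (br1 u v) = br1 (psib x u) v + (-1) ^+ (i * j) *: br1 u (psib x v)};
  mod_psim_mul : forall i j, {in homog A i & homog A j, forall x y v,
    psim (mulA x y) v = psim x (psim y v)};
  mod_mul_mul : forall i j k, {in homog A i & homog V j & homog V k, forall x u v,
    psim x (mul1 u v) = mul1 (psim x u) v};
  mod_psib_mul : forall i j, {in homog A i & homog A j, forall x y v,
    psib (mulA x y) v = psim x (psib y v) + (-1) ^+ (i * j) *: psim y (psib x v)};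
  mod_psim_br : forall i j, {in homog A i & homog A j, forall x y v,
    psim (brA x y) v = psib x (psim y v) - (-1) ^+ (i * j) *: psim y (psib x v)};
  mod_br_mul : forall i j k, {in homog A i & homog V j & homog V k, forall x u v,
    psib x (mul1 u v) = mul1 (psib x u) v + (-1) ^+ (i * j) *: mul1 u (psib x v)};
  mod_mul_br : forall i j k, {in homog A i & homog V j & homog V k, forall x u v,
    psim x (br1 u v) = mul1 (psib x u) v + (-1) ^+ (i * j) *: br1 u (psim x v)}
}.

Record O_operator (K : fieldType) (A V : superspace K)
    (brA mulA : A -> A -> A) (br1 mul1 : V -> V -> V) (psib psim : A -> V -> V)
    (lambda : K) (T : V -> A) : Prop := OOperator {
  O_even : even_linear T;
  O_br : forall i j, {in homog V i & homog V j, forall u v,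
    brA (T u) (T v) =
      T (psib (T u) v - (-1) ^+ (i * j) *: psib (T v) u + lambda *: br1 u v)};
  O_mul : forall i j, {in homog V i & homog V j, forall u v,
    mulA (T u) (T v) =
      T (psim (T u) v + (-1) ^+ (i * j) *: psim (T v) u + lambda *: mul1 u v)}
}.

Record post_lie (K : fieldType) (V : superspace K) (lie dia : V -> V -> V) : Prop :=
  PostLie {
  post_lie_lie : super_lie lie;
  post_lie_dia_even : even_bilinear dia;
  post_lie_dia : forall i j k, {in homog V i & homog V j & homog V k, forall x y z,
    (-1) ^+ (k * j) *: dia z (dia y x) - dia y (dia z x) + dia (dia y z) x
      - (-1) ^+ (k * j) *: dia (dia z y) x + dia (lie y z) x = 0};
  post_lie_der : forall i j k, {in homog V i & homog V j & homog V k, forall x y z,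
    dia z (lie x y) - lie (dia z x) y - (-1) ^+ (k * i) *: lie x (dia z y) = 0}
}.

Record comm_dendriform_trialgebra (K : fieldType) (V : superspace K)
    (dot succ : V -> V -> V) : Prop := CommDendriformTrialgebra {
  dend_dot_even : even_bilinear dot;
  dend_succ_even : even_bilinear succ;
  dend_dotC : forall i j, {in homog V i & homog V j, forall x y,
    dot x y = (-1) ^+ (i * j) *: dot y x};
  dend_dotA : forall i j k, {in homog V i & homog V j & homog V k, forall x y z,
    dot (dot x y) z = dot x (dot y z)};
  dend_succA : forall i j k, {in homog V i & homog V j & homog V k, forall x y z,
    succ x (succ y z) = succ (succ x y + (-1) ^+ (i * j) *: succ y x + dot x y) z};
  dend_succ_dot : forall i j k, {in homog V i & homog V j & homog V k, forall x y z,
    dot (succ x y) z = succ x (dot y z)}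
}.

Record post_poisson_superalgebra (K : fieldType) (V : superspace K)
    (lie dia dot succ : V -> V -> V) : Prop := PostPoissonSuperalgebra {
  pp_post_lie : post_lie lie dia;
  pp_dendriform : comm_dendriform_trialgebra dot succ;
  pp_lie_dot : forall i j k, {in homog V i & homog V j & homog V k, forall x y z,
    lie x (dot y z) = dot (lie x y) z + (-1) ^+ (i * j) *: dot y (lie x z)};
  pp_lie_succ : forall i j k, {in homog V i & homog V j & homog V k, forall x y z,
    lie x (succ z y) = (-1) ^+ (i * k) *: succ z (lie x y)
      - (-1) ^+ (j * k + i * j + i * k) *: dot y (dia z x)};
  pp_dia_dot : forall i j k, {in homog V i & homog V j & homog V k, forall x y z,
    dia x (dot y z) = dot (dia x y) z + (-1) ^+ (i * j) *: dot y (dia x z)};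
  pp_mul_dia : forall i j k, {in homog V i & homog V j & homog V k, forall x y z,
    dia (succ y z + (-1) ^+ (j * k) *: succ z y + dot y z) x =
      (-1) ^+ (j * k) *: succ z (dia y x) + succ y (dia z x)};
  pp_dia_succ : forall i j k, {in homog V i & homog V j & homog V k, forall x y z,
    dia x (succ z y) = (-1) ^+ (i * k) *: succ z (dia x y)
      + succ (dia x z - (-1) ^+ (i * k) *: dia z x + lie x z) y}
}.

Definition assoc_br (K : fieldType) (V : superspace K) (lie dia : V -> V -> V)
    (u v : V) : V :=
  dia u v - superflip dia u v + lie u v.

Definition assoc_mul (K : fieldType) (V : superspace K) (dot succ : V -> V -> V)
    (u v : V) : V :=
  succ u v + superflip succ u v + dot u v.

(* Main.v *)
(* Scaling both operations of V by lambda preserves the module axioms, so that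
   lambda disappears.  Each post-Poisson axiom is then a module axiom for
   elements T u of A, in which the O-operator identities turn brackets and
   products of such elements into values of T.  The axioms of the associated
   Poisson superalgebra follow from the post-Poisson ones alone: they are signed
   sums of a few normal-form triple products. *)

Require Import Defs.
From mathcomp Require Import all_boot all_order all_algebra.

Set Implicit Arguments.
Unset Strict Implicit.
Unset Printing Implicit Defensive.

Import GRing.Theory.
Local Open Scope ring_scope.

(** * Reflexive proof of identities between signed sums *)

Inductive zterm :=
  | ZAtom of nat | ZZero | ZOpp of zterm | ZAdd of zterm & zterm | ZSign of nat & zterm.

(** Coefficients live in [int] rather than in the field, so that they can be compared by
    computation. *)
Fixpoint zcoef (t : zterm) (i : nat) : int :=
  match t with
  | ZAtom n => if n == i then 1 else 0
  | ZZero => 0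
  | ZOpp t => - zcoef t i
  | ZAdd s t => zcoef s i + zcoef t i
  | ZSign n t => if odd n then - zcoef t i else zcoef t i
  end.

Fixpoint zval {K : fieldType} {V : lmodType K} (e : seq V) (t : zterm) : V :=
  match t with
  | ZAtom n => e`_n
  | ZZero => 0
  | ZOpp t => - zval e t
  | ZAdd s t => zval e s + zval e t
  | ZSign n t => (-1) ^+ n *: zval e t
  end.

Lemma zvalE (K : fieldType) (V : lmodType K) (e : seq V) (t : zterm) :
  zval e t = \sum_(i < size e) e`_i *~ zcoef t i.
Proof.
elim: t => [n||t IHt|s IHs t IHt|n t IHt] /=.
- have [ltn|len] := ltnP n (size e).
    rewrite (bigD1 (Ordinal ltn)) //= eqxx big1 ?addr0 // => i.
    by rewrite -val_eqE /= eq_sym => /negPf ->.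
  (* An atom index past the end of [e] has the default value 0, and no index of the sum equals
     it. *)
  rewrite nth_default // big1 // => i _.
  by rewrite gtn_eqF // (leq_trans (ltn_ord i)).
- by rewrite big1.
- by rewrite IHt -sumrN; apply: eq_bigr => i _; rewrite mulrNz.
- by rewrite IHs IHt -big_split; apply: eq_bigr => i _; rewrite mulrzDr.
- rewrite -signr_odd IHt; case: odd; rewrite ?expr0 ?scale1r // expr1 scaleN1r.
  by rewrite -sumrN; apply: eq_bigr => i _; rewrite mulrNz.
Qed.

(** Soundness of the procedure: by [zvalE] both values are integer combinations of the entries of
    [e], so agreement of the coefficients suffices. *)
Lemma zval_eq (K : fieldType) (V : lmodType K) (e : seq V) (s t : zterm) :
  all (fun i => zcoef s i == zcoef t i) (iota 0 (size e)) -> zval e s = zval e t.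
Proof.
move/allP=> st; rewrite !zvalE; apply: eq_bigr => i _.
by rewrite (eqP (st i _)) // mem_iota ltn_ord.
Qed.

(** Subterms are identified syntactically; a scaling by anything but a power of -1 is itself an
    atom. *)
Ltac zatoms e u :=
  match u with
  | GRing.zero => e
  | GRing.opp ?a => zatoms e a
  | GRing.add ?a ?b => let e := zatoms e a in zatoms e b
  | GRing.scale ((-1) ^+ _) ?a => zatoms e a
  | _ =>
    let rec mem l := match l with
      | nil => constr:(cons u e)
      | cons u _ => e
      | cons _ ?l => mem l
      end in mem e
  end.

Ltac zreify e u :=
  match u with
  | GRing.zero => constr:(ZZero)
  | GRing.opp ?a => let t := zreify e a in constr:(ZOpp t)
  | GRing.add ?a ?b =>
    let s := zreify e a in let t := zreify e b in constr:(ZAdd s t)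
  | GRing.scale ((-1) ^+ ?n) ?a => let t := zreify e a in constr:(ZSign n t)
  | _ =>
    let rec idx l := match l with
      | cons u _ => constr:(O)
      | cons _ ?l => let n := idx l in constr:(S n)
      end in let n := idx e in constr:(ZAtom n)
  end.

(* Needs every sign (-1) ^+ n to have a closed exponent, hence the case analyses
   on all parities before each use. *)
Ltac signed_sum :=
  match goal with |- @eq ?X ?u ?v =>
    let e := zatoms (@nil X) u in let e := zatoms e v in
    let s := zreify e u in let t := zreify e v in
    apply: (@zval_eq _ _ e s t); vm_compute; reflexivity
  end.

Lemma scalerC (K : fieldType) (V : lmodType K) (a b : K) (v : V) :
  a *: (b *: v) = b *: (a *: v).
Proof. by rewrite !scalerA mulrC. Qed.

(** * Linearity of the parity components *)

Section Homogeneous.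
Variables (K : fieldType) (V : superspace K).
Implicit Types (i : bool) (u v : V).

Lemma homogZ i (a : K) u : u \in homog V i -> a *: u \in homog V i.
Proof.
move=> ui; have [V0 Vlin] := homog_submod V i.
by rewrite -[a *: u]addr0 Vlin.
Qed.

Lemma homogD i u v : u \in homog V i -> v \in homog V i -> u + v \in homog V i.
Proof.
by move=> ui vi; have [_ Vlin] := homog_submod V i; rewrite -[u]scale1r Vlin.
Qed.

(** The components are obtained by choice, so linearity rests on the uniqueness of the decomposition
    into an even and an odd vector. *)
Lemma parity_part_linear i : linear (parity_part i : V -> V).
Proof.
move=> a u v; set w := a *: u + v.
have sumE : parity_part false w + parity_part true w =
    a *: parity_part false u + parity_part false v
    + (a *: parity_part true u + parity_part true v).
  by rewrite parity_part_sum addrACA -scalerDr !parity_part_sum.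
have partP j : a *: parity_part j u + parity_part j v \in homog V j.
  exact: homogD (homogZ a (parity_partP j u)) (parity_partP j v).
have p0E : parity_part false w = a *: parity_part false u + parity_part false v.
  (* The difference of the two candidate even parts is even, and by [sumE] it is also a difference
     of odd vectors, hence zero. *)
  apply/subr0_eq/homog_cap.
    exact: homogB (parity_partP _ _) (partP _).
  have -> : parity_part false w - (a *: parity_part false u + parity_part false v) =
      a *: parity_part true u + parity_part true v - parity_part true w.
    by rewrite -[X in X - _](addrK (parity_part true w)) sumE; signed_sum.
  exact: homogB (partP _) (parity_partP _ _).
case: i => //; rewrite -[LHS](addKr (parity_part false w)) sumE p0E.
by signed_sum.
Qed.

End Homogeneous.

(** * Even bilinear maps *)

Section Bilinear.
Variables (K : fieldType) (U V W : superspace K).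
Implicit Type op : U -> V -> W.

(** Stated as a tuple so that it serves as a single multi-rule, expanding sums, opposites and
    scalings in both arguments. *)
Lemma bilinear_distr op : bilinear_for *:%R *:%R op ->
  (forall u u' v, op (u + u') v = op u v + op u' v) *
  (forall u v v', op u (v + v') = op u v + op u v') *
  (forall u v, op (- u) v = - op u v) *
  (forall u v, op u (- v) = - op u v) *
  (forall a u v, op (a *: u) v = a *: op u v) *
  (forall a u v, op u (a *: v) = a *: op u v).
Proof.
move=> [opl opr].
have Dl u u' v : op (u + u') v = op u v + op u' v.
  by have := opl v 1 u u'; rewrite /= !scale1r.
have Dr u v v' : op u (v + v') = op u v + op u v'.
  by have := opr u 1 v v'; rewrite /= !scale1r.
have l0 v : op 0 v = 0 by apply: (addrI (op 0 v)); rewrite -Dl !addr0.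
have r0 u : op u 0 = 0 by apply: (addrI (op u 0)); rewrite -Dr !addr0.
have Zl a u v : op (a *: u) v = a *: op u v.
  by have := opl v a u 0; rewrite /= l0 !addr0.
have Zr a u v : op u (a *: v) = a *: op u v.
  by have := opr u a v 0; rewrite /= r0 !addr0.
by do !split => //; move=> u v; rewrite -scaleN1r ?Zl ?Zr scaleN1r.
Qed.

(** Splitting both arguments into even and odd parts leaves four homogeneous pairs. This carries
    identities known for homogeneous elements over to all elements. *)
Lemma bilinear_homog_ext op op' :
  bilinear_for *:%R *:%R op -> bilinear_for *:%R *:%R op' ->
  (forall i j, {in homog U i & homog V j, forall u v, op u v = op' u v}) ->
  forall u v, op u v = op' u v.
Proof.
move=> /bilinear_distr opE /bilinear_distr op'E eq_op u v.
have [u0 [u1 [u0P u1P ->]]] := homog_sum u.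
have [v0 [v1 [v0P v1P ->]]] := homog_sum v.
rewrite !opE !op'E (eq_op _ _ _ _ u0P v0P) (eq_op _ _ _ _ u0P v1P).
by rewrite (eq_op _ _ _ _ u1P v0P) (eq_op _ _ _ _ u1P v1P).
Qed.

Lemma even_bilinearD op op' : even_bilinear op -> even_bilinear op' ->
  even_bilinear (fun u v => op u v + op' u v).
Proof.
move=> [bop eop] [bop' eop']; split.
  have opE := bilinear_distr bop; have op'E := bilinear_distr bop'.
  by split=> w a u v /=; rewrite !opE !op'E scalerDr addrACA.
by move=> i j u v ui vj; apply: homogD; [apply: eop | apply: eop'].
Qed.

Lemma even_bilinearZ (c : K) op : even_bilinear op ->
  even_bilinear (fun u v => c *: op u v).
Proof.
move=> [bop eop]; split.
  have opE := bilinear_distr bop.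
  by split=> w a u v /=; rewrite !opE scalerDr scalerC.
by move=> i j u v ui vj; apply: homogZ; apply: eop.
Qed.

Lemma even_bilinear_ext op op' : (forall u v, op u v = op' u v) ->
  even_bilinear op -> even_bilinear op'.
Proof.
move=> eq_op [[opl opr] eop]; split; first split.
- by move=> w a u v; rewrite -!eq_op; apply: opl.
- by move=> w a u v; rewrite -!eq_op; apply: opr.
- by move=> i j u v ui vj; rewrite -eq_op; apply: eop.
Qed.

End Bilinear.

Lemma even_bilinear_comp (K : fieldType) (U U' V W : superspace K)
    (T : U' -> U) (op : U -> V -> W) :
  even_linear T -> even_bilinear op -> even_bilinear (fun u v => op (T u) v).
Proof.
move=> [linT evT] [bop eop]; split.
  have opE := bilinear_distr bop.
  by split=> w a u v /=; rewrite ?linT !opE.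
by move=> i j u v ui vj; apply: eop => //; apply: evT.
Qed.

Lemma superflip_even (K : fieldType) (V : superspace K) (op : V -> V -> V) :
  even_bilinear op -> even_bilinear (superflip op).
Proof.
move=> hop; have [bop eop] := hop; have opE := bilinear_distr bop.
split; last first.
  move=> i j u v ui vj; rewrite (superflipE hop ui vj) addbC.
  by apply: homogZ; apply: eop.
split=> w a u v; rewrite /= /superflip scaler_sumr -big_split.
  apply: eq_bigr => i _; rewrite scaler_sumr -big_split; apply: eq_bigr => j _ /=.
  by rewrite parity_part_linear !opE scalerDr scalerC.
apply: eq_bigr => i _; rewrite scaler_sumr -big_split; apply: eq_bigr => j _ /=.
by rewrite parity_part_linear !opE scalerDr scalerC.
Qed.

(** * The Poisson superalgebra associated to a post-Poisson superalgebra *)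

Section AssociatedPoisson.
Variables (K : fieldType) (V : superspace K) (lie dia dot succ : V -> V -> V).

Lemma assoc_br_even :
  even_bilinear lie -> even_bilinear dia -> even_bilinear (assoc_br lie dia).
Proof.
move=> elie edia; apply: even_bilinearD => //.
have := even_bilinearD edia
  (even_bilinearZ (-1) (superflip_even edia)).
by apply: even_bilinear_ext => u v; rewrite scaleN1r.
Qed.

Lemma assoc_mul_even :
  even_bilinear dot -> even_bilinear succ -> even_bilinear (assoc_mul dot succ).
Proof.
move=> edot esucc; apply: even_bilinearD => //.
by apply: even_bilinearD => //; apply: superflip_even.
Qed.

Lemma assoc_brE i j u v : even_bilinear dia -> u \in homog V i -> v \in homog V j ->
  assoc_br lie dia u v = dia u v - (-1) ^+ (i * j) *: dia v u + lie u v.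
Proof. by move=> edia ui vj; rewrite /assoc_br (superflipE edia ui vj). Qed.

Lemma assoc_mulE i j u v : even_bilinear succ -> u \in homog V i -> v \in homog V j ->
  assoc_mul dot succ u v = succ u v + (-1) ^+ (i * j) *: succ v u + dot u v.
Proof. by move=> esucc ui vj; rewrite /assoc_mul (superflipE esucc ui vj). Qed.

(** The operators [dia x] represent the new bracket and are superderivations of [lie]. Hence, in the
    cyclic sum, all terms containing [dia] cancel, and the Jacobi identity of [lie] remains. *)
Lemma post_lie_assoc : post_lie lie dia -> super_lie (assoc_br lie dia).
Proof.
case=> [[elie skew jac] edia diaA der].
have lieE := bilinear_distr elie.1.
have diaE := bilinear_distr edia.1.
have ebr := assoc_br_even elie edia.
split=> //.
- move=> i j x y xi yj; rewrite (assoc_brE edia xi yj).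
  rewrite (assoc_brE edia yj xi) (skew _ _ _ _ xi yj).
  by destruct i, j; signed_sum.
(* This is [diaA] for the permuted arguments z, x, y, read as a representation property. *)
- have dia_br i j k x y z : x \in homog V i -> y \in homog V j -> z \in homog V k ->
      dia (assoc_br lie dia x y) z
        = dia x (dia y z) - (-1) ^+ (i * j) *: dia y (dia x z).
    move=> xi yj zk; rewrite (assoc_brE edia xi yj) !diaE.
    apply/eqP; rewrite -subr_eq0 -(diaA _ _ _ _ _ _ zk xi yj); apply/eqP.
    by destruct i, j; signed_sum.
  (* Normal form of a double bracket: by skew symmetry, every [lie] that contains a [dia] has it in
     its second argument. *)
  have br3 i j k x y z : x \in homog V i -> y \in homog V j -> z \in homog V k ->
      assoc_br lie dia x (assoc_br lie dia y z) =
      dia x (dia y z) - (-1) ^+ (j * k) *: dia x (dia z y)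
      - (-1) ^+ (i * (j (+) k)) *:
          (dia y (dia z x) - (-1) ^+ (j * k) *: dia z (dia y x))
      - (-1) ^+ ((i (+) j) * k) *: lie z (dia x y)
      + (-1) ^+ (i * j) *: lie y (dia x z)
      + lie x (dia y z) - (-1) ^+ (j * k) *: lie x (dia z y) + lie x (lie y z).
    move=> xi yj zk; rewrite (assoc_brE edia xi (ebr.2 _ _ _ _ yj zk)).
    rewrite (dia_br _ _ _ _ _ _ yj zk xi) (assoc_brE edia yj zk).
    have -> : dia x (dia y z - (-1) ^+ (j * k) *: dia z y + lie y z) =
        dia x (dia y z) - (-1) ^+ (j * k) *: dia x (dia z y) + dia x (lie y z).
      by rewrite !diaE.
    have -> : dia x (lie y z) =
        lie (dia x y) z + (-1) ^+ (i * j) *: lie y (dia x z).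
      apply/eqP; rewrite -subr_eq0 opprD addrA.
      by rewrite (der _ _ _ _ _ _ yj zk xi).
    rewrite (skew _ _ _ _ (edia.2 _ _ _ _ xi yj) zk) !lieE.
    by destruct i, j, k; signed_sum.
  move=> i j k x y z xi yj zk.
  rewrite (br3 _ _ _ _ _ _ xi yj zk) (br3 _ _ _ _ _ _ zk xi yj).
  (* The right-hand 0 is replaced by the Jacobi sum of [lie], to be matched term by term. *)
  rewrite (br3 _ _ _ _ _ _ yj zk xi) -(jac _ _ _ _ _ _ xi yj zk).
  by destruct i, j, k; signed_sum.
Qed.

(** For associativity, the dendriform axioms bring all triple products to a common form. For the
    Leibniz rule, the compatibility axioms evaluate [dia x] and [lie x] on a product, and [dia] of a
    product on [x]. *)
Lemma post_poisson_assoc :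
  post_poisson_superalgebra lie dia dot succ ->
  poisson_superalgebra (assoc_br lie dia) (assoc_mul dot succ).
Proof.
case=> pl [edot esucc dotC dotA succA succ_dot] lie_dot lie_succ dia_dot mul_dia dia_succ.
have [[elie skew _] edia _ _] := pl.
have lieE := bilinear_distr elie.1.
have diaE := bilinear_distr edia.1.
have dotE := bilinear_distr edot.1.
have succE := bilinear_distr esucc.1.
have ebr := assoc_br_even elie edia.
have emul := assoc_mul_even edot esucc.
have succ_mul i j k x y z : x \in homog V i -> y \in homog V j -> z \in homog V k ->
    succ (assoc_mul dot succ x y) z = succ x (succ y z).
  by move=> xi yj zk; rewrite (assoc_mulE esucc xi yj) (succA _ _ _ _ _ _ xi yj zk).
(* The operators [succ x] supercommute because [succA] factors them through a product that is
   supercommutative. *)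
have succCA i j k x y z : x \in homog V i -> y \in homog V j -> z \in homog V k ->
    succ x (succ y z) = (-1) ^+ (i * j) *: succ y (succ x z).
  move=> xi yj zk; rewrite (succA _ _ _ _ _ _ xi yj zk) (succA _ _ _ _ _ _ yj xi zk).
  rewrite -[RHS]succE; congr succ; rewrite (dotC _ _ _ _ xi yj).
  by destruct i, j; signed_sum.
have dot_succ i j k x y z : x \in homog V i -> y \in homog V j -> z \in homog V k ->
    dot x (succ y z) = (-1) ^+ (i * j) *: succ y (dot x z).
  move=> xi yj zk; rewrite (dotC _ _ _ _ xi (esucc.2 _ _ _ _ yj zk)).
  rewrite (succ_dot _ _ _ _ _ _ yj zk xi) (dotC _ _ _ _ zk xi) !succE.
  by destruct i, j, k; signed_sum.
split=> //.
- exact: post_lie_assoc.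
- move=> i j x y xi yj; rewrite (assoc_mulE esucc xi yj) (assoc_mulE esucc yj xi).
  by rewrite (dotC _ _ _ _ xi yj); destruct i, j; signed_sum.
- move=> i j k x y z xi yj zk.
  rewrite (assoc_mulE esucc xi (emul.2 _ _ _ _ yj zk)) (assoc_mulE esucc (emul.2 _ _ _ _ xi yj) zk).
  rewrite (succ_mul _ _ _ _ _ _ yj zk xi) (succ_mul _ _ _ _ _ _ xi yj zk).
  rewrite (assoc_mulE esucc yj zk) (assoc_mulE esucc xi yj) !(succE, dotE).
  rewrite (dotA _ _ _ _ _ _ xi yj zk) (succ_dot _ _ _ _ _ _ xi yj zk).
  rewrite (succ_dot _ _ _ _ _ _ yj xi zk) (dot_succ _ _ _ _ _ _ xi yj zk).
  rewrite (dot_succ _ _ _ _ _ _ xi zk yj) (succCA _ _ _ _ _ _ xi zk yj).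
  rewrite (succCA _ _ _ _ _ _ yj zk xi).
  by destruct i, j, k; signed_sum.
- move=> i j k x y z xi yj zk.
  rewrite (assoc_brE edia xi (emul.2 _ _ _ _ yj zk)).
  rewrite (assoc_mulE esucc (ebr.2 _ _ _ _ xi yj) zk) (assoc_mulE esucc yj (ebr.2 _ _ _ _ xi zk)).
  have -> : dia (assoc_mul dot succ y z) x =
      (-1) ^+ (j * k) *: succ z (dia y x) + succ y (dia z x).
    by rewrite (assoc_mulE esucc yj zk) (mul_dia _ _ _ _ _ _ xi yj zk).
  rewrite (assoc_mulE esucc yj zk).
  (* The inner sum in [dia_succ] is the new bracket; it is kept folded, since the same terms occur
     on the other side of the Leibniz rule. *)
  have -> : dia x (succ y z + (-1) ^+ (j * k) *: succ z y + dot y z) =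
      (-1) ^+ (i * j) *: succ y (dia x z) + succ (assoc_br lie dia x y) z
      + (-1) ^+ (j * k) *: ((-1) ^+ (i * k) *: succ z (dia x y)
                            + succ (assoc_br lie dia x z) y)
      + (dot (dia x y) z + (-1) ^+ (i * j) *: dot y (dia x z)).
    rewrite !diaE (dia_succ _ _ _ _ _ _ xi zk yj) (dia_succ _ _ _ _ _ _ xi yj zk).
    by rewrite (dia_dot _ _ _ _ _ _ xi yj zk) (assoc_brE edia xi yj) (assoc_brE edia xi zk).
  have -> : lie x (succ y z + (-1) ^+ (j * k) *: succ z y + dot y z) =
      lie x (succ y z) + (-1) ^+ (j * k) *: lie x (succ z y) + lie x (dot y z).
    by rewrite !lieE.
  rewrite (lie_succ _ _ _ _ _ _ xi zk yj) (lie_succ _ _ _ _ _ _ xi yj zk).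
  rewrite (lie_dot _ _ _ _ _ _ xi yj zk).
  (* The brackets in the first argument of [succ] already match on both sides; only those in the
     other positions are expanded here. *)
  rewrite [in succ z (assoc_br _ _ _ _)](assoc_brE edia xi yj).
  rewrite [in succ y (assoc_br _ _ _ _)](assoc_brE edia xi zk).
  rewrite [in dot (assoc_br _ _ _ _)](assoc_brE edia xi yj).
  rewrite [in dot y (assoc_br _ _ _ _)](assoc_brE edia xi zk).
  rewrite ![succ z (_ + _)]succE ![succ y (_ + _)]succE !dotE !succE.
  (* [lie_succ] produces this product with its factors in the opposite order. *)
  rewrite (dotC _ _ _ _ zk (edia.2 _ _ _ _ yj xi)).
  by destruct i, j, k; signed_sum.
Qed.

End AssociatedPoisson.

(** * Rescaling the operations by a constant *)

Section Scaling.
Variables (K : fieldType) (c : K).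

(** In each identity all terms contain the same number of operations, one or two, so a common power
    of [c] factors out. *)
Lemma poisson_scale (P : superspace K) (br mul : P -> P -> P) :
  poisson_superalgebra br mul ->
  poisson_superalgebra (fun u v => c *: br u v) (fun u v => c *: mul u v).
Proof.
case=> [[ebr skew jac] emul mulC mulA leib].
have brE := bilinear_distr ebr.1; have mulE := bilinear_distr emul.1.
split; first split.
- exact: even_bilinearZ.
- by move=> i j x y xi yj; rewrite (skew _ _ _ _ xi yj) scalerN scalerC.
- move=> i j k x y z xi yj zk; rewrite !brE ![_ ^+ _ *: (c *: _)]scalerC -!scalerDr.
  by rewrite (jac _ _ _ _ _ _ xi yj zk) !scaler0.
- exact: even_bilinearZ.
- by move=> i j x y xi yj; rewrite (mulC _ _ _ _ xi yj) scalerC.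
- by move=> i j k x y z xi yj zk; rewrite !mulE (mulA _ _ _ _ _ _ xi yj zk).
- move=> i j k x y z xi yj zk; rewrite !brE !mulE (leib _ _ _ _ _ _ xi yj zk).
  by rewrite !scalerDr ![_ ^+ _ *: (c *: _)]scalerC.
Qed.

(** In the identities that involve [br1] or [mul1], every term contains exactly one of them. The
    identity mixing both survives because they are scaled by the same [c]. *)
Lemma module_poisson_scale (A V : superspace K) (brA mulA : A -> A -> A)
    (br1 mul1 : V -> V -> V) (psib psim : A -> V -> V) :
  module_poisson_superalgebra brA mulA br1 mul1 psib psim ->
  module_poisson_superalgebra brA mulA (fun u v => c *: br1 u v)
    (fun u v => c *: mul1 u v) psib psim.
Proof.
case=> pV eb em bbr brbr mmul mulmul bmul mbr brmul mulbr.
have bE := bilinear_distr eb.1; have mE := bilinear_distr em.1.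
split=> //; first exact: poisson_scale.
- move=> i j k x u v xi uj vk; rewrite bE (brbr _ _ _ _ _ _ xi uj vk).
  by rewrite scalerDr scalerC.
- by move=> i j k x u v xi uj vk; rewrite mE (mulmul _ _ _ _ _ _ xi uj vk).
- move=> i j k x u v xi uj vk; rewrite bE (brmul _ _ _ _ _ _ xi uj vk).
  by rewrite scalerDr scalerC.
- move=> i j k x u v xi uj vk; rewrite mE (mulbr _ _ _ _ _ _ xi uj vk).
  by rewrite scalerDr scalerC.
Qed.

End Scaling.

(** * The post-Poisson structure induced by an O-operator *)

Theorem theorem6p2 (K : fieldType) (charK : [pchar K] =i pred0)
    (A V : superspace K) (brA mulA : A -> A -> A) (br1 mul1 : V -> V -> V)
    (psib psim : A -> V -> V) (lambda : K) (T : V -> A)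
    (hA : poisson_superalgebra brA mulA)
    (hV : module_poisson_superalgebra brA mulA br1 mul1 psib psim)
    (hT : O_operator brA mulA br1 mul1 psib psim lambda T) :
  let lie := fun u v : V => lambda *: br1 u v in
  let dia := fun u v : V => psib (T u) v in
  let dot := fun u v : V => lambda *: mul1 u v in
  let succ := fun u v : V => psim (T u) v in
  post_poisson_superalgebra lie dia dot succ /\
  poisson_hom (assoc_br lie dia) (assoc_mul dot succ) brA mulA T.
Proof.
move=> lie dia dot succ.
have [eT Tbr Tmul] := hT; have [linT evT] := eT.
have {}Tbr : forall i j, {in homog V i & homog V j, forall u v,
  brA (T u) (T v) = T (dia u v - (-1) ^+ (i * j) *: dia v u + lie u v)} := Tbr.
have {}Tmul : forall i j, {in homog V i & homog V j, forall u v,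
  mulA (T u) (T v) = T (succ u v + (-1) ^+ (i * j) *: succ v u + dot u v)} := Tmul.
have {hV} : module_poisson_superalgebra brA mulA lie dot psib psim.
  exact: module_poisson_scale.
case=> pV eb em bbr brbr mmul mulmul bmul mbr brmul mulbr.
(* Generalizing over [lie] and [dot] forgets their definitions, and [lambda] with them; [dia] and
   [succ] remain defined through [T]. *)
move: lie dot Tbr Tmul pV brbr mulmul brmul mulbr => {hT} lie dot.
move=> Tbr Tmul [hlie edot dotC dotA leib] brbr mulmul brmul mulbr.
have edia : even_bilinear dia := even_bilinear_comp eT eb.
have esucc : even_bilinear succ := even_bilinear_comp eT em.
have elie := lie_even hlie.
have diaE := bilinear_distr edia.1; have succE := bilinear_distr esucc.1.
have lieE := bilinear_distr elie.1; have dotE := bilinear_distr edot.1.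
have TV i u : u \in homog V i -> T u \in homog A i by exact: evT.
have hP : post_poisson_superalgebra lie dia dot succ.
  split; [split=> // | split=> // | ..] => i j k x y z xi yj zk.
  - rewrite -addrA -addrA [X in _ + X]addrA.
    (* The action of the bracket of [T y] and [T z] on [x] is computed in two ways: as a
       supercommutator, and through [T] by the O-operator identity. *)
    have := bbr _ _ _ _ (TV _ _ yj) (TV _ _ zk) x.
    rewrite (Tbr _ _ _ _ yj zk) -/(dia _ x) !diaE => /eqP.
    rewrite -subr_eq0 => /eqP E; rewrite -[RHS]E /dia.
    by destruct i, j, k; signed_sum.
  - rewrite /dia (brbr _ _ _ _ _ _ (TV _ _ zk) xi yj).
    by destruct i, j, k; signed_sum.
  - by rewrite (dotA _ _ _ _ _ _ xi yj zk).
  - by rewrite /succ -(mmul _ _ _ _ (TV _ _ xi) (TV _ _ yj)) (Tmul _ _ _ _ xi yj).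
  - by rewrite /succ (mulmul _ _ _ _ _ _ (TV _ _ xi) yj zk).
  - exact: leib xi yj zk.
  - rewrite /succ (mulbr _ _ _ _ _ _ (TV _ _ zk) xi yj).
    (* Moving [dia z x] past [y] contributes the terms [j * k] and [i * j] of the exponent; solving
       for [lie x (succ z y)] contributes [i * k]. *)
    rewrite (dotC _ _ _ _ (edia.2 _ _ _ _ zk xi) yj).
    by destruct i, j, k; signed_sum.
  - exact: brmul (TV _ _ xi) yj zk.
  - rewrite {1}/dia -(Tmul _ _ _ _ yj zk) (bmul _ _ _ _ (TV _ _ yj) (TV _ _ zk)).
    by rewrite addrC.
  - rewrite [in succ (_ + _) y]/succ -(Tbr _ _ _ _ xi zk).
    rewrite (mbr _ _ _ _ (TV _ _ xi) (TV _ _ zk)) /dia /succ.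
    by destruct i, j, k; signed_sum.
split=> //; have bE := bilinear_distr (lie_even (poisson_lie hA)).1.
have mE := bilinear_distr (poisson_mul_even hA).1.
have eabr := bilinear_distr (assoc_br_even elie edia).1.
have eamul := bilinear_distr (assoc_mul_even edot esucc).1.
split=> //; first exact: post_poisson_assoc.
(* On homogeneous elements the homomorphism property is the O-operator identity itself; bilinearity
   extends it. *)
- apply: bilinear_homog_ext => [||i j u v ui vj].
  + by split=> w a u v /=; rewrite !eabr linT.
  + by split=> w a u v /=; rewrite !linT !bE.
  + by rewrite (Tbr _ _ _ _ ui vj) (assoc_brE _ edia ui vj).
- apply: bilinear_homog_ext => [||i j u v ui vj].
  + by split=> w a u v /=; rewrite !eamul linT.
  + by split=> w a u v /=; rewrite !linT !mE.
  + by rewrite (Tmul _ _ _ _ ui vj) (assoc_mulE _ esucc ui vj).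
Qed.
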